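(* Let $G$ be a permutation graph and let $\overline{G}$ denote its complement. Then $t(G) \leq \chi(\overline{G}) = \omega(\overline{G}) = \alpha(G)$.
   Context: A graph $G=(V,E)$ is a threshold graph if there exist non-negative reals $w_v$ ($v\in V$) and $t$ such that for every $U\subseteq V$, $\sum_{v\in U} w_v \le t$ if and only if $U$ is a stable (independent) set. The threshold dimension $t(G)$ of a graph $G$ is the least integer $k$ such that there are threshold graphs $T_1,\dots,T_k$ with $V(T_i)=V(G)$ for all $i$ and $E(G)=E(T_1)\cup\cdots\cup E(T_k)$. For a permutation $\Pi$ of $\{1,\dots,n\}$, the graph $G[\Pi]$ has vertex set $\{1,\dots,n\}$ and $i,j$ adjacent iff $(i-j)(\Pi^{-1}(i)-\Pi^{-1}(j))<0$; a graph is a permutation graph if it is isomorphic to $G[\Pi]$ for some permutation $\Pi$. $\alpha$, $\omega$, $\chi$ denote independence number, clique number and chromatic number. *)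

(* Defs.v *)
From mathcomp Require Import all_boot all_order all_fingroup all_algebra.
From mathcomp Require Import boolp reals.

Set Implicit Arguments.
Unset Strict Implicit.
Unset Printing Implicit Defensive.

Import Order.TTheory GRing.Theory Num.Theory.

Record graph (V : finType) := Graph {
  adj : rel V;
  adj_sym : symmetric adj;
  adj_irr : irreflexive adj }.

Definition isomorphic (V W : finType) (G : graph V) (H : graph W) : Prop :=
  exists2 f : V -> W, bijective f & forall x y, adj H (f x) (f y) = adj G x y.

Section Invariants.
Context (V : finType) (G : graph V).

Lemma compl_sym : symmetric [rel x y | (x != y) && ~~ adj G x y].
Proof. by move=> x y; rewrite /= eq_sym adj_sym. Qed.

Lemma compl_irr : irreflexive [rel x y | (x != y) && ~~ adj G x y].
Proof. by move=> x; rewrite /= eqxx. Qed.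

Definition compl : graph V := Graph compl_sym compl_irr.

Definition stable (U : {set V}) : bool :=
  [forall x in U, forall y in U, ~~ adj G x y].

Definition clique (U : {set V}) : bool :=
  [forall x in U, forall y in U, (x != y) ==> adj G x y].

Definition independence_number : nat := \max_(U : {set V} | stable U) #|U|.

Definition clique_number : nat := \max_(U : {set V} | clique U) #|U|.

Definition colorable (k : nat) : bool :=
  [exists c : {ffun V -> 'I_k},
     forall x, forall y, adj G x y ==> (c x != c y)].

Lemma colorable_ex : exists k, colorable k.
Proof.
exists #|V|; apply/existsP; exists [ffun x => enum_rank x].
apply/forallP => x; apply/forallP => y; apply/implyP => xy.
rewrite !ffunE; apply: contraTneq xy => /enum_rank_inj ->.
by rewrite adj_irr.
Qed.

Definition chromatic_number : nat := ex_minn colorable_ex.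

End Invariants.

Definition threshold (R : realType) (V : finType) (G : graph V) : Prop :=
  exists (w : V -> R) (t : R),
    [/\ forall v, (0 <= w v)%R, (0 <= t)%R &
        forall U : {set V}, (\sum_(v in U) w v <= t)%R <-> stable G U].

Definition threshold_cover (R : realType) (V : finType) (G : graph V)
    (k : nat) : Prop :=
  exists T : 'I_k -> graph V,
    (forall i, threshold R (T i)) /\
    (forall x y, adj G x y <-> exists i, adj (T i) x y).

Section SingleEdge.
Context (V : finType) (a b : V) (ab : a != b).

Let e := [rel x y : V | (x == a) && (y == b) || (x == b) && (y == a)].

Lemma edge_sym : symmetric e.
Proof. by move=> x y; rewrite /= orbC andbC [X in _ || X]andbC. Qed.

Lemma edge_irr : irreflexive e.
Proof.
move=> x /=; rewrite [X in _ || X]andbC orbb.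
by apply: contraNF ab => /andP[/eqP <- /eqP <-].
Qed.

Definition edge_graph : graph V := Graph edge_sym edge_irr.

Lemma edge_threshold (R : realType) : threshold R edge_graph.
Proof.
exists (fun v => ((v == a) || (v == b))%:R%R), 1%R.
split=> [v||U]; [exact: ler0n|exact: ler01|].
have -> : (\sum_(v in U) ((v == a) || (v == b))%:R)%R
          = (((a \in U) + (b \in U))%N%:R)%R :> R.
  rewrite -natr_sum big_mkcond /=; congr (_%:R)%R.
  rewrite (bigD1 a) //= (bigD1 b) 1?eq_sym //= !eqxx orbT.
  rewrite big1 => [|v /andP[/negPf-> /negPf->]]; last by case: ifP.
  by case: (a \in U); case: (b \in U).
rewrite (ler_nat R _ 1); split=> [le1|/forall_inP st].
  apply/forall_inP => x xU; apply/forall_inP => y yU /=.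
  apply: contraTN le1 => /orP[]/andP[/eqP xE /eqP yE];
    by rewrite -xE -yE xU yU.
case aU: (a \in U); case bU: (b \in U) => //.
by have /forall_inP/(_ b bU) := st a aU; rewrite /= !eqxx.
Qed.

End SingleEdge.

Lemma threshold_cover_ex (R : realType) (V : finType) (G : graph V) :
  exists k, `[< threshold_cover R G k >].
Proof.
pose E := [pred p : V * V | adj G p.1 p.2].
have nE (i : 'I_#|E|) : (enum_val i).1 != (enum_val i).2.
  by have := enum_valP i; apply: contraTneq => /=; rewrite inE => ->; rewrite adj_irr.
exists #|E|; apply/asboolP; exists (fun i => edge_graph (nE i)); split.
  by move=> i; exact: edge_threshold.
move=> x y; split=> [xy|[i] /=].
  have Exy : (x, y) \in E by [].
  by exists (enum_rank_in Exy (x, y)); rewrite /= enum_rankK_in //= !eqxx.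
have := enum_valP i; rewrite inE => Ei.
by move=> /orP[]/andP[/eqP-> /eqP->] //; rewrite adj_sym.
Qed.

(* The least k may be 0: an edgeless graph is the union of an empty family. *)
Definition threshold_dimension (R : realType) (V : finType) (G : graph V) : nat :=
  ex_minn (threshold_cover_ex R G).

Section PermutationGraph.
Context (n : nat) (p : 'S_n).

(* The points are 0, ..., n-1 instead of 1, ..., n; only differences matter. *)
Definition inversion : rel 'I_n := fun i j =>
  (((i : nat)%:Z - (j : nat)%:Z)
     * (((p^-1)%g i : nat)%:Z - ((p^-1)%g j : nat)%:Z) < 0)%R.

Lemma inversion_sym : symmetric inversion.
Proof. by move=> i j; rewrite /inversion -mulrNN !opprB. Qed.

Lemma inversion_irr : irreflexive inversion.
Proof. by move=> i; rewrite /inversion subrr mul0r ltxx. Qed.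

Definition perm_graph : graph 'I_n := Graph inversion_sym inversion_irr.

End PermutationGraph.

Definition is_permutation_graph (V : finType) (G : graph V) : Prop :=
  exists (n : nat) (p : 'S_n), isomorphic G (perm_graph p).

(* Main.v *)
Require Import Defs.
From mathcomp Require Import all_boot all_order all_fingroup all_algebra.
From mathcomp Require Import boolp reals.
From mathcomp Require Import zify.

Import GRing.Theory Num.Theory.

(** Both [G] and its complement have transitive orientations: place vertex [i]
    at the point [(i, p^-1 i)]; edges of [G] go right and down, edges of the
    complement go right and up. Colouring the complement by the height in its
    orientation gives [chi = omega]. A colour class of the complement is a
    chain [K] for the orientation [r] of [G], and the edges of [G] leaving [K]
    form a threshold graph, since the sets of [r]-predecessors in [K] are
    initial segments of [K] and hence nested. Every edge of [G] leaves some
    colour class, so these threshold graphs cover [G]. *)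

(** * Threshold graphs from the edges leaving a chain *)

Section OutEdges.
Context {V : finType} (r : rel V) (K : {set V}).
Hypothesis r_irr : irreflexive r.
Hypothesis r_trans : transitive r.
Hypothesis K_chain :
  forall x y, x \in K -> y \in K -> x != y -> r x y || r y x.

Let e := [rel x y | (x \in K) && r x y || (y \in K) && r y x].

Lemma out_edges_sym : symmetric e.
Proof. by move=> x y; rewrite /= orbC. Qed.

Lemma out_edges_irr : irreflexive e.
Proof. by move=> x; rewrite /= r_irr andbF. Qed.

Definition out_edges : graph V := Graph out_edges_sym out_edges_irr.

Definition chain_rank (v : V) : nat := #|[set k in K | r k v]|.

(** If [k] precedes [v], so do all predecessors of [k]; otherwise every predecessor of [v] in the
    chain must lie below [k]. *)
Lemma chain_rankP (k v : V) : k \in K -> r k v = (chain_rank k < chain_rank v).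
Proof.
move=> kK; apply/idP/idP => [rkv|].
  apply: proper_card; apply/properP; split.
    apply/subsetP => x; rewrite !inE => /andP[-> rxk].
    exact: r_trans rxk rkv.
  by exists k; rewrite !inE ?kK ?rkv // r_irr andbF.
apply: contraLR => nrkv; rewrite -leqNgt; apply: subset_leq_card.
apply/subsetP => x; rewrite !inE => /andP[xK rxv]; rewrite xK /=.
have neq : x != k by apply: contraNneq nrkv => <-.
case/orP: (K_chain _ _ xK kK neq) => // rkx.
by rewrite (r_trans _ _ _ rkx rxv) in nrkv.
Qed.

(* Outside [K] the weights grow so fast with the rank that a single vertex
   outweighs all those of smaller rank; a vertex [k] of [K] gets exactly what is
   left of [t] by the vertices outside [K] not adjacent to it; and [t] is so
   large that two vertices of [K] exceed it. *)
Let W (v : V) := #|V|.+1 ^ chain_rank v.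
Let S (j : nat) := \sum_(v | (v \notin K) && (chain_rank v <= j)) W v.
Let Stot := \sum_(v | v \notin K) W v.
Let t := (Stot + Stot).+1.
Let w (v : V) := if v \in K then t - S (chain_rank v) else W v.

Lemma lower_weight_le j : S j <= Stot.
Proof.
rewrite /Stot (bigID (fun v => chain_rank v <= j)) /=; exact: leq_addr.
Qed.

(** At most [#|V|] terms, each at most [#|V|.+1 ^ j], stay below the next power. *)
Lemma lower_weight_lt j v : j < chain_rank v -> S j < W v.
Proof.
move=> jv; apply: (@leq_trans (#|V|.+1 ^ j.+1)); last by rewrite leq_pexp2l.
have /leq_ltn_trans : S j <= \sum_(v : V) #|V|.+1 ^ j.
  rewrite /S big_mkcond; apply: leq_sum => u _.
  by case: ifP => // /andP[_ uj]; rewrite leq_pexp2l.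
by apply; rewrite sum_nat_const expnS ltn_pmul2r // expn_gt0.
Qed.

Lemma out_edge_weight x y : x \in K -> r x y -> t < w x + w y.
Proof.
move=> xK rxy; rewrite /w xK.
have := lower_weight_le (chain_rank x).
case: ifP => yK.
  (* Both weights are at least [t - Stot = Stot + 1], so they add up to at least [t + 1]. *)
  have := lower_weight_le (chain_rank y); rewrite /t; lia.
rewrite chain_rankP // in rxy.
have := lower_weight_lt _ _ rxy; rewrite /t; lia.
Qed.

Lemma two_weights_le (U : {set V}) x y :
  x \in U -> y \in U -> x != y -> w x + w y <= \sum_(v in U) w v.
Proof.
move=> xU yU xy; rewrite (bigD1 x) //= (bigD1 y) /=; last by rewrite yU eq_sym.
by rewrite addnA leq_addr.
Qed.

Lemma out_edges_weight_le (U : {set V}) :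
  (\sum_(v in U) w v <= t) = stable out_edges U.
Proof.
apply/idP/idP => [le|/forall_inP st].
  apply/forall_inP => x xU; apply/forall_inP => y yU; apply/negP => /= xy.
  have neq : x != y by apply: contraTneq xy => ->; rewrite r_irr andbF.
  have := leq_trans (two_weights_le _ _ _ xU yU neq) le.
  case/orP: xy => /andP[K' r'].
    by rewrite leqNgt out_edge_weight.
  by rewrite addnC leqNgt out_edge_weight.
have nr x y : x \in U -> y \in U -> x \in K -> ~~ r x y.
  move=> xU yU xK; have /forall_inP/(_ y yU) := st x xU.
  by rewrite /= xK negb_or => /andP[].
have [/exists_inP[k kU kK]|/exists_inPn noK] := boolP [exists k in U, k \in K].
  rewrite (bigD1 k) //=.
  (* As [K] is a chain, [k] is the only vertex of [U] in [K]; the others are not above [k], so their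
     rank is at most that of [k]. *)
  have sub : \sum_(v in U | v != k) w v <= S (chain_rank k).
    rewrite big_mkcond /S [X in _ <= X]big_mkcond; apply: leq_sum => v _ /=.
    case: ifP => // /andP[vU vk].
    have vK : v \notin K.
      apply/negP => vK; have := K_chain _ _ vK kK vk.
      by rewrite (negPf (nr _ _ vU kU vK)) (negPf (nr _ _ kU vU kK)).
    rewrite /w (negPf vK) /= [chain_rank v <= _]leqNgt -chain_rankP //.
    by rewrite (negPf (nr _ _ kU vU kK)).
  have wk : w k = t - S (chain_rank k) by rewrite /w kK.
  have := lower_weight_le (chain_rank k); rewrite wk /t; lia.
have le : \sum_(v in U) w v <= Stot.
  rewrite big_mkcond /Stot [X in _ <= X]big_mkcond; apply: leq_sum => v _ /=.
  by case: ifP => // /noK vK; rewrite /w vK (negPf vK).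
by rewrite /t; lia.
Qed.

Lemma out_edges_threshold (R : realType) : threshold R out_edges.
Proof.
exists (fun v => (w v)%:R%R), (t%:R)%R; split=> [v||U]; try exact: ler0n.
by rewrite -natr_sum ler_nat out_edges_weight_le.
Qed.

End OutEdges.

(** A strict order whose comparability graph is [G]; asymmetry follows from the first two
    clauses. *)
Definition transitive_orientation (V : finType) (G : graph V) (r : rel V) :=
  [/\ irreflexive r, transitive r & forall x y, adj G x y = r x y || r y x].

Lemma threshold_cover_of_coloring (R : realType) (V : finType) (G : graph V)
    (r : rel V) (k : nat) :
  transitive_orientation V G r -> colorable (compl G) k -> threshold_cover R G k.
Proof.
case=> r_irr r_trans adjE /existsP[c /forallP cP].
pose K i := [set v | c v == i].
exists (fun i => out_edges r (K i) r_irr); split.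
  move=> i; apply: out_edges_threshold => // x y.
  rewrite !inE => /eqP cx /eqP cy xy; rewrite -adjE.
  move/forallP/(_ y): (cP x); rewrite /= xy /= cx cy eqxx.
  by case: (adj G x y).
move=> x y; rewrite adjE; split=> [/orP[]|[i] /=].
- by move=> xy; exists (c x); rewrite /= inE eqxx xy.
- by move=> yx; exists (c y); rewrite /= [y \in _]inE eqxx yx orbT.
- by move=> /orP[]/andP[_ ->]; rewrite ?orbT.
Qed.

(** * Perfection of comparability graphs *)

Lemma clique_le_colorable (V : finType) (H : graph V) (k : nat) :
  colorable H k -> clique_number H <= k.
Proof.
move=> /existsP[c /forallP cP]; apply/bigmax_leqP => U /forall_inP clU.
have c_inj : {in U &, injective c}.
  move=> x y xU yU cxy; apply/eqP; apply: contraT => xy.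
  have /forall_inP/(_ y yU) := clU x xU; rewrite xy /= => adjxy.
  by move/forallP/(_ y): (cP x); rewrite adjxy cxy eqxx.
by rewrite -(card_in_imset c_inj) -[X in _ <= X]card_ord max_card.
Qed.

Lemma colorable_clique_number (V : finType) (H : graph V) (s : rel V) :
  transitive_orientation V H s -> colorable H (clique_number H).
Proof.
case=> s_irr s_trans adjE.
(* Cliques with greatest element [v]; the height [h v] is the largest size of one. *)
pose below v (C : {set V}) :=
  [&& clique H C, v \in C & [forall u in C, (u != v) ==> s u v]].
pose h v := \max_(C | below v C) #|C|.
have below1 v : below v [set v].
  apply/and3P; split; last 2 first.
  - by rewrite inE.
  - by apply/forall_inP => u; rewrite inE => ->.
  apply/forall_inP => x /set1P->; apply/forall_inP => y /set1P->.
  by rewrite eqxx.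
have h_gt0 v : 0 < h v.
  by rewrite -(cards1 v); apply: leq_bigmax_cond.
have h_le v : h v <= clique_number H.
  apply/bigmax_leqP => C /and3P[clC _ _].
  exact: (leq_bigmax_cond (P := clique H) (F := fun U : {set V} => #|U|)).
(* A largest clique topped by [u] stays a clique when [v] is put on top. *)
have h_lt u v : s u v -> h u < h v.
  move=> suv.
  have [|C bC hE] := @eq_bigmax_cond _ (below u) (fun C : {set V} => #|C|).
    by apply/card_gt0P; exists [set u]; exact: below1.
  rewrite [h u]hE; case/and3P: bC => /forall_inP clC uC /forall_inP Cu.
  have Cv x : x \in C -> s x v.
    move=> xC; have [->//|xu] := eqVneq x u.
    by apply: s_trans suv; have := Cu x xC; rewrite xu.
  have vC : v \notin C by apply/negP => /Cv; rewrite s_irr.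
  have -> : #|C|.+1 = #|v |: C| by rewrite cardsU1 vC.
  apply: leq_bigmax_cond; apply/and3P; split; last 2 first.
  - exact: setU11.
  - apply/forall_inP => x; rewrite in_setU1 => /orP[->//|xC].
    by apply/implyP => _; exact: Cv.
  apply/forall_inP => x; rewrite in_setU1 => xvC.
  apply/forall_inP => y; rewrite in_setU1 => yvC; apply/implyP.
  case/orP: xvC => [/eqP->|xC]; case/orP: yvC => [/eqP->|yC] xy.
  - by rewrite eqxx in xy.
  - by rewrite adjE Cv ?orbT.
  - by rewrite adjE Cv.
  - by have /forall_inP/(_ y yC) := clC x xC; rewrite xy.
(* Heights start at 1 and colours at 0; positivity keeps the shift injective. *)
have h_ord v : (h v).-1 < clique_number H by rewrite prednK.
apply/existsP; exists [ffun v => Ordinal (h_ord v)].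
apply/forallP => x; apply/forallP => y; apply/implyP; rewrite adjE !ffunE.
rewrite -val_eqE /=; have := h_gt0 x; have := h_gt0 y.
by move=> hy hx /orP[]/h_lt; lia.
Qed.

Lemma chromatic_eq_clique (V : finType) (H : graph V) (s : rel V) :
  transitive_orientation V H s -> chromatic_number H = clique_number H.
Proof.
move=> sP; rewrite /chromatic_number; case: ex_minnP => k kP kmin.
apply/eqP; rewrite eqn_leq clique_le_colorable // andbT.
exact: kmin (colorable_clique_number _ _ _ sP).
Qed.

Lemma clique_compl (V : finType) (G : graph V) (U : {set V}) :
  clique (compl G) U = stable G U.
Proof.
apply: eq_forallb_in => x _; apply: eq_forallb_in => y _ /=.
by have [->|] := eqVneq x y; rewrite ?adj_irr.
Qed.

Lemma clique_number_compl (V : finType) (G : graph V) :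
  clique_number (compl G) = independence_number G.
Proof. by apply: eq_bigl => U; exact: clique_compl. Qed.

(** * The two orders on the points of a permutation *)

Section PermutationOrders.
Context {n : nat} (p : 'S_n).
Local Notation q := (p^-1)%g.

Definition falling : rel 'I_n := fun i j => (i < j) && (q j < q i).
Definition rising : rel 'I_n := fun i j => (i < j) && (q i < q j).

Lemma falling_irr : irreflexive falling.
Proof. by move=> i; rewrite /falling ltnn. Qed.

Lemma rising_irr : irreflexive rising.
Proof. by move=> i; rewrite /rising ltnn. Qed.

Lemma falling_trans : transitive falling.
Proof. by move=> j i k; rewrite /falling; lia. Qed.

Lemma rising_trans : transitive rising.
Proof. by move=> j i k; rewrite /rising; lia. Qed.

Lemma inversionE i j : inversion p i j = falling i j || falling j i.
Proof.
rewrite /inversion /falling.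
move: (nat_of_ord (q i)) (nat_of_ord (q j)) => a b.
by apply/idP/idP; nia.
Qed.

Lemma noninversionE i j :
  (i != j) && ~~ inversion p i j = rising i j || rising j i.
Proof.
rewrite inversionE /falling /rising.
(* Distinct points never share a second coordinate, so each pair either rises or falls. *)
have : (i == j) = (q i == q j) by rewrite (inj_eq perm_inj).
rewrite -!val_eqE /=; lia.
Qed.

End PermutationOrders.

(** Both orders are pulled back along the isomorphism. *)
Lemma permutation_graph_orientation (V : finType) (G : graph V) :
  is_permutation_graph G ->
  exists r s, transitive_orientation V G r /\ transitive_orientation V (compl G) s.
Proof.
case=> n [p [f /bij_inj f_inj adjE]].
exists (relpre f (falling p)), (relpre f (rising p)); split; split.
- by move=> x; exact: falling_irr.
- by move=> y x z; exact: falling_trans.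
- by move=> x y; rewrite -adjE /= inversionE.
- by move=> x; exact: rising_irr.
- by move=> y x z; exact: rising_trans.
- by move=> x y; rewrite /= -noninversionE -adjE (inj_eq f_inj).
Qed.

Theorem theorem4 (R : realType) (V : finType) (G : graph V)
    (hG : is_permutation_graph G) :
  [/\ threshold_dimension R G <= chromatic_number (compl G),
      chromatic_number (compl G) = clique_number (compl G) &
      clique_number (compl G) = independence_number G].
Proof.
have [r [s [rP sP]]] := permutation_graph_orientation _ _ hG.
split; last exact: clique_number_compl.
  rewrite /threshold_dimension; case: ex_minnP => k _; apply; apply/asboolP.
  apply: threshold_cover_of_coloring rP _.
  by rewrite /chromatic_number; case: ex_minnP.
exact: chromatic_eq_clique sP.
Qed.
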